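(* Let $A$ be a $W(k)$-algebra, let $e$ be a primitive idempotent of $Z_n$, let $V$ be a co-Whittaker $A[G_n]$-module in $e\mathrm{Rep}_{W(k)}(G_n)$, and fix an isomorphism $f:V^{(n)}\cong A$ of $A$-modules. Let $A'$ be a $W(k)$-subalgebra of $A$, and suppose that the composition $$\text{c-Ind}_{U_n}^{P_n}\psi_{A'}\to\text{c-Ind}_{U_n}^{P_n}\psi_A\to V\to\mathrm{Ind}_{U_n}^{G_n}\psi_A$$ has image contained in $\mathrm{Ind}_{U_n}^{G_n}\psi_{A'}$. Then the map $eZ_n\to A$ giving the action of $eZ_n$ on $V$ factors through $A'$.
   Context: $F$ is a $p$-adic field, $G_n=\mathrm{GL}_n(F)$, $k$ an algebraically closed field of characteristic $\ell\ne p$; all algebras are commutative. Fix a nontrivial smooth additive character $\psi:F\to W(k)^\times$. $U_n\subset G_n$ is the group of unipotent upper triangular matrices, with character $\psi(u)=\psi(u_{12}+\dots+u_{n-1,n})$; $P_n\subset G_n$ is the mirabolic subgroup of matrices with last row $(0,\dots,0,1)$. For a module $M$, $\psi_M$ is $M$ with $U_n$ acting through $\psi$. $\mathrm{Ind}$ (resp. $\text{c-Ind}$) is smooth (resp. compactly supported modulo $U_n$) induction, viewed as functions $h$ with $h(ug)=\psi(u)h(g)$ with the group acting by right translation. For a smooth $A[G_n]$-module $V$, $V^{(n)}=V/\langle uv-\psi(u)v\rangle_{u\in U_n,v\in V}$ ($\psi$-coinvariants; this also makes sense for smooth $A[P_n]$-modules). $V$ is co-Whittaker if (1) $V$ is admissible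 ($V^K$ is finitely generated over $A$ for every compact open $K$); (2) $V^{(n)}$ is free of rank one over $A$; (3) any quotient $W$ of $V$ with $W^{(n)}=0$ is zero. Then $\mathrm{End}_{A[G_n]}(V)=A$. $Z_n$ is the center (natural endomorphisms of the identity functor) of the category $\mathrm{Rep}_{W(k)}(G_n)$ of smooth $W(k)[G_n]$-modules; for a primitive idempotent $e$ of $Z_n$, $e\mathrm{Rep}_{W(k)}(G_n)$ is the full subcategory on which $e$ acts as the identity. For $V$ co-Whittaker in it, $eZ_n$ acts on $V$ through a map $eZ_n\to A$. Maps in the composition: the first is the inclusion. For the second, evaluation at the identity identifies $(\text{c-Ind}_{U_n}^{P_n}\psi_M)^{(n)}$ with $M$, and (Bernstein–Zelevinsky) there is a unique $A[P_n]$-homomorphism $\text{c-Ind}_{U_n}^{P_n}\psi_{V^{(n)}}\to V$ inducing the identity of $V^{(n)}$ on $\psi$-coinvariants; the second map is this one, with $V^{(n)}$ identified with $A$ by $f$. The third map sends $v$ to its Whittaker function $w_f(v):g\mapsto f(\overline{gv})$, where $\overline{gv}$ is the image of $gv$ in $V^{(n)}$. *)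

(* Defs.v *)
From HB Require Import structures.
From mathcomp Require Import all_boot all_order all_algebra.
From mathcomp Require Import generic_quotient ring_quotient.
From mathcomp Require Import boolp classical_sets topology.

Set Implicit Arguments.
Unset Strict Implicit.
Unset Printing Implicit Defensive.

Import GRing.Theory.
Local Open Scope classical_set_scope.
Local Open Scope ring_scope.

(** * p-adic fields *)

(* [padic_val x] is the normalized valuation of [x] when [x != 0]; the value
   of [padic_val 0] is irrelevant, every bound on the valuation goes through
   [val_ge], for which the valuation of [0] is infinite. *)
Definition val_ge (F : nmodType) (v : F -> int) (m : int) (x : F) : Prop :=
  x = 0 \/ (m <= v x)%R.

(* A p-adic field: a complete discretely valued field of characteristic 0 with
   finite residue field of characteristic p, with its valuation topology. *)
HB.mixin Record isPAdicField (p : nat) F of GRing.Field F & Topological F := {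
  padic_val : F -> int;
  padic_prime : prime p;
  padic_valM : forall x y : F, x != 0 -> y != 0 ->
    padic_val (x * y) = padic_val x + padic_val y;
  padic_valD : forall (m : int) (x y : F),
    val_ge padic_val m x -> val_ge padic_val m y -> val_ge padic_val m (x + y);
  padic_uniformizer : exists2 t : F, t != 0 & padic_val t = 1;
  padic_nbhsE : forall (x : F) (S : set F), nbhs x S <->
    exists m : int, forall y, val_ge padic_val m (y - x) -> S y;
  padic_complete : forall u : nat -> F,
    (forall m : int, exists N : nat, forall a b : nat,
      (N <= a)%N -> (N <= b)%N -> val_ge padic_val m (u a - u b)) ->
    exists x : F, u @ \oo --> x;
  padic_pchar0 : [pchar F] =i pred0;
  padic_residue_pchar : val_ge padic_val 1 (p%:R : F);
  padic_residue_finite : exists s : seq F, forall x : F, val_ge padic_val 0 x ->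
    exists2 y, y \in s & val_ge padic_val 1 (x - y)
}.

#[short(type="padicFieldType")]
HB.structure Definition PAdicField (p : nat) :=
  {F of isPAdicField p F & GRing.Field F & Topological F}.

(** * Witt vectors *)

(* [W], with [red : W -> k], is the ring of Witt vectors of the perfect field
   [k] of characteristic [l]: the strict [l]-ring with residue ring [k] (Serre,
   Local Fields, II.5), unique up to unique isomorphism, i.e. [W] is [l]-torsion
   free, separated and complete for the [l]-adic topology, and [red] induces an
   isomorphism of [W / l W] with [k]. *)
Record is_Witt_ring (l : nat) (k : fieldType) (W : comNzRingType)
    (red : {rmorphism W -> k}) : Prop := {
  witt_pchar : l \in [pchar k];
  witt_surj : forall c : k, exists x : W, red x = c;
  witt_ker : forall x : W, red x = 0 <-> exists y : W, x = l%:R * y;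
  witt_reg : forall x : W, l%:R * x = 0 -> x = 0;
  witt_sep : forall x : W,
    (forall m : nat, exists y : W, x = l%:R ^+ m * y) -> x = 0;
  witt_complete : forall u : nat -> W,
    (forall m : nat, exists y : W, u m.+1 - u m = l%:R ^+ m * y) ->
    exists x : W, forall m : nat, exists y : W, x - u m = l%:R ^+ m * y
}.

(* Values are units of [W] because [psi 0 = 1]; smoothness of a character means
   that its kernel is open. *)
Record nontrivial_smooth_character (p : nat) (F : padicFieldType p)
    (W : comNzRingType) (psi : F -> W) : Prop := {
  psi0 : psi 0 = 1;
  psiD : forall x y : F, psi (x + y) = psi x * psi y;
  psi_smooth : open [set x : F | psi x = 1];
  psi_nontrivial : exists x : F, psi x <> 1
}.

(** * Groups with a topology *)

(* No compatibility of the group law with the topology is required; the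
   structure is used for [GL] and its mirabolic subgroup. *)
#[short(type="preTopologicalGroupType")]
HB.structure Definition PreTopologicalGroup := {G of Group G & Topological G}.

Section GeneralLinearGroup.
Variables (p : nat) (F : padicFieldType p) (n : nat).

Record GL := MkGL { gl_mx :> 'M[F]_n; gl_unit : gl_mx \in unitmx }.

HB.instance Definition _ := [isSub for gl_mx].
HB.instance Definition _ := [Choice of GL by <:].

Definition gl1 := MkGL (unitmx1 F n).
Lemma gl_mul_subproof (g h : GL) : gl_mx g *m gl_mx h \in unitmx.
Proof. by rewrite unitmx_mul !gl_unit. Qed.
Definition gl_mul (g h : GL) := MkGL (gl_mul_subproof g h).
Lemma gl_inv_subproof (g : GL) : invmx (gl_mx g) \in unitmx.
Proof. by rewrite unitmx_inv gl_unit. Qed.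
Definition gl_inv (g : GL) := MkGL (gl_inv_subproof g).

Lemma gl_mulA : associative gl_mul.
Proof. by move=> a b c; apply/val_inj/mulmxA. Qed.
Lemma gl_mul1 : left_id gl1 gl_mul.
Proof. by move=> a; apply/val_inj/mul1mx. Qed.
Lemma gl_mulr1 : right_id gl1 gl_mul.
Proof. by move=> a; apply/val_inj/mulmx1. Qed.
Lemma gl_mulV : left_inverse gl1 gl_inv gl_mul.
Proof. by move=> a; apply/val_inj/mulVmx/gl_unit. Qed.
Lemma gl_mulrV : right_inverse gl1 gl_inv gl_mul.
Proof. by move=> a; apply/val_inj/mulmxV/gl_unit. Qed.

HB.instance Definition _ :=
  isGroup.Build GL gl_mulA gl_mul1 gl_mulr1 gl_mulV gl_mulrV.
(* The subspace topology of the space of matrices. *)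
HB.instance Definition _ := Topological.copy GL (initial_topology gl_mx).

Definition mirabolic_pred : {pred GL} := fun g =>
  [forall i : 'I_n, forall j : 'I_n,
    (i.+1 == n) ==> (gl_mx g i j == (i == j)%:R)].

Lemma mirabolicP (g : GL) : reflect
  (forall i j : 'I_n, i.+1 = n -> gl_mx g i j = (i == j)%:R)
  (g \in mirabolic_pred).
Proof.
apply: (iffP forallP) => [gP i j /eqP il|gP i].
  by apply/eqP; move/forallP: (gP i) => /(_ j); rewrite il.
by apply/forallP => j; apply/implyP => /eqP il; rewrite gP.
Qed.

Lemma mirabolic_row (g : GL) (B : 'M[F]_n) (i j : 'I_n) :
  g \in mirabolic_pred -> i.+1 = n -> (gl_mx g *m B) i j = B i j.
Proof.
move=> /mirabolicP gP il; rewrite mxE (bigD1 i) //= gP // eqxx mul1r.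
by rewrite big1 ?addr0 // => k ki; rewrite gP // eq_sym (negPf ki) mul0r.
Qed.

Lemma mirabolic_group_closed : group_closed mirabolic_pred.
Proof.
split; first by apply/mirabolicP => i j _; rewrite mxE.
move=> g h gP hP; apply/mirabolicP => i j il.
rewrite [gl_mx _]/= (mirabolic_row _ _ gP il).
rewrite -(mirabolic_row _ _ hP il) [gl_mx h *m _]mulmxV ?gl_unit //.
by rewrite mxE.
Qed.

Record mirabolic := MkMirabolic
  { mir_gl :> GL; mir_pred : mir_gl \in mirabolic_pred }.

HB.instance Definition _ := [isSub for mir_gl].
HB.instance Definition _ := [Choice of mirabolic by <:].
HB.instance Definition _ :=
  SubChoice_isSubGroup.Build GL mirabolic_pred mirabolic mirabolic_group_closed.
HB.instance Definition _ := Topological.copy mirabolic (initial_topology mir_gl).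

Definition unipotent : set GL :=
  [set u | forall i j : 'I_n, (j <= i)%N -> gl_mx u i j = (i == j)%:R].

Definition superdiag_sum (u : GL) : F :=
  \sum_(i < n) \sum_(j < n | j == i.+1 :> nat) gl_mx u i j.

(* The character [psi] of the unipotent group with values in a [W]-algebra [R]
   of structure map [eta]; it is a character on [unipotent] only. *)
Definition psiU (W : Type) (R : Type) (eta : W -> R) (psi : F -> W) (u : GL) : R :=
  eta (psi (superdiag_sum u)).

End GeneralLinearGroup.

(** * Smooth representations *)

Definition subgroup (G : groupType) (K : set G) : Prop :=
  [/\ K 1%g, forall x y, K x -> K y -> K (x * y)%g & forall x, K x -> K (x^-1)%g].

Record smoothRep (G : preTopologicalGroupType) (R : pzRingType) := SmoothRep {
  rep_mod :> lmodType R;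
  act : G -> rep_mod -> rep_mod;
  act_linear : forall g, linear (act g);
  act1 : forall v, act 1%g v = v;
  actM : forall g h v, act (g * h)%g v = act g (act h v);
  act_smooth : forall v, open [set g | act g v = v]
}.

Section Representations.
Variables (G : preTopologicalGroupType) (R : pzRingType).

Record repHom (V V' : smoothRep G R) := RepHom {
  hom_fun :> {linear V -> V'};
  hom_equiv : forall g v, hom_fun (act g v) = act g (hom_fun v)
}.

Definition invariants (V : smoothRep G R) (K : set G) : set V :=
  [set v | forall g, K g -> act g v = v].

Definition admissible (V : smoothRep G R) : Prop :=
  forall K : set G, subgroup K -> open K -> compact K ->
  exists (m : nat) (s : 'I_m -> V), (forall i, invariants K (s i)) /\
  forall v, invariants K v -> exists c : 'I_m -> R, v = \sum_i c i *: s i.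

(* Induction from a subgroup [U] of the one-dimensional character [chi] acting
   on an [R]-module [M]; [chi] matters only on [U]. *)
Definition Ind (U : set G) (chi : G -> R) (M : lmodType R) : set (G -> M) :=
  [set h | (forall u g, U u -> h (u * g)%g = chi u *: h g) /\
           open [set k | forall g, h (g * k)%g = h g]].

Definition cInd (U : set G) (chi : G -> R) (M : lmodType R) : set (G -> M) :=
  [set h | Ind U chi h /\ exists C : set G, compact C /\
    forall g, h g <> 0 -> exists u c, [/\ U u, C c & g = (u * c)%g]].

(** ** Coinvariants *)

Section Coinvariants.
Variables (U : set G) (chi : G -> R) (V : smoothRep G R).

(* The [R]-submodule generated by the [u v - chi(u) v]. *)
Definition coinv_ker : {pred V} := fun v =>
  `[< forall S : submodClosed V,
        (forall u w, U u -> act u w - chi u *: w \in S) -> v \in S >].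

Lemma coinv_ker_closed : submod_closed coinv_ker.
Proof.
split; first by apply/asboolP => S _; exact: rpred0.
move=> a v w /asboolP vS /asboolP wS; apply/asboolP => S SP.
by apply: rpredD; [apply: rpredZ; exact: vS | exact: wS].
Qed.

HB.instance Definition _ := GRing.isSubmodClosed.Build R V coinv_ker coinv_ker_closed.

Definition coinv := Quotient.quot coinv_ker.
HB.instance Definition _ := GRing.Zmodule.on coinv.
HB.instance Definition _ := EqQuotient.on coinv.

Definition coinv_proj (v : V) : coinv := \pi_(coinv)%qT v.

Lemma coinv_projB (v w : V) :
  v - w \in coinv_ker -> coinv_proj v = coinv_proj w.
Proof. by move=> vw; apply/eqP; rewrite -Quotient.idealrBE. Qed.

Lemma coinv_projD : {morph coinv_proj : v w / v + w}.
Proof. by move=> v w; exact: (@Quotient.pi_add V coinv_ker). Qed.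

Lemma coinv_reprK (x : coinv) : coinv_proj (repr x) = x.
Proof. exact: reprK. Qed.

Definition coinv_scale (a : R) (x : coinv) : coinv := coinv_proj (a *: repr x).

Lemma coinv_projZ (a : R) (v : V) :
  coinv_proj (a *: v) = coinv_scale a (coinv_proj v).
Proof.
apply: coinv_projB; rewrite -scalerBr; apply: rpredZ.
by rewrite Quotient.idealrBE reprK.
Qed.

Lemma coinv_scaleA a b x : coinv_scale a (coinv_scale b x) = coinv_scale (a * b) x.
Proof. by rewrite -[x]coinv_reprK -!coinv_projZ scalerA. Qed.
Lemma coinv_scale1 : left_id 1 coinv_scale.
Proof. by move=> x; rewrite -[x]coinv_reprK -coinv_projZ scale1r. Qed.
Lemma coinv_scaleDr : right_distributive coinv_scale +%R.
Proof.
move=> a x y; rewrite -[x]coinv_reprK -[y]coinv_reprK.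
by rewrite -coinv_projD -!coinv_projZ -coinv_projD scalerDr.
Qed.
Lemma coinv_scaleDl x : {morph coinv_scale^~ x : a b / a + b}.
Proof.
move=> a b /=; rewrite -[x]coinv_reprK -!coinv_projZ -coinv_projD.
by rewrite scalerDl.
Qed.

HB.instance Definition _ := GRing.Zmodule_isLmodule.Build R coinv
  coinv_scaleA coinv_scale1 coinv_scaleDr coinv_scaleDl.

End Coinvariants.

(* The quotients of [V] are its images under surjective homomorphisms. *)
Record co_Whittaker (U : set G) (chi : G -> R) (V : smoothRep G R) : Prop := {
  coW_admissible : admissible V;
  coW_rank1 : exists f : {linear coinv U chi V -> R^o}, bijective f;
  coW_quotient : forall (Q : smoothRep G R) (q : repHom V Q),
    (forall y : Q, exists x : V, q x = y) ->
    (forall y : coinv U chi Q, y = 0) -> forall y : Q, y = 0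
}.

(** ** Bernstein center *)

(* Only the part of the ring structure of the center which is used is
   introduced, as a Type-valued family over all representations is too large
   to carry a ring structure of the library. *)
Record center := Center {
  center_at :> forall V : smoothRep G R, repHom V V;
  center_natural : forall (V V' : smoothRep G R) (h : repHom V V') (v : V),
    center_at V' (h v) = h (center_at V v)
}.

Definition idempotent_center (e : center) : Prop :=
  forall (V : smoothRep G R) (v : V), e V (e V v) = e V v.

Definition zero_center (e : center) : Prop :=
  forall (V : smoothRep G R) (v : V), e V v = 0.

(* A nonzero idempotent which is not the sum of two nonzero orthogonal
   idempotents. *)
Definition primitive_idempotent (e : center) : Prop :=
  [/\ idempotent_center e, ~ zero_center e &
      forall e1 e2 : center,
        idempotent_center e1 -> idempotent_center e2 ->
        (forall (V : smoothRep G R) (v : V), e1 V (e2 V v) = 0) ->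
        (forall (V : smoothRep G R) (v : V), e V v = e1 V v + e2 V v) ->
        zero_center e1 \/ zero_center e2].

Definition in_block (e : center) (V : smoothRep G R) : Prop :=
  forall v : V, e V v = v.

Definition block_center (e : center) :=
  {z : center | forall (V : smoothRep G R) (v : V), e V (z V v) = z V v}.

End Representations.

(** * Restriction of scalars *)

Definition restrict_mod (W R : pzRingType) (eta : {rmorphism W -> R})
  (M : lmodType R) : Type := M.

Section Restriction.
Variables (W R : pzRingType) (eta : {rmorphism W -> R}).

Section Mod.
Variable M : lmodType R.
Local Notation rM := (restrict_mod eta M).

HB.instance Definition _ := GRing.Zmodule.copy rM M.

Definition restrict_scale (a : W) (x : rM) : rM := eta a *: (x : M).

Lemma restrict_scaleA a b x :
  restrict_scale a (restrict_scale b x) = restrict_scale (a * b) x.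
Proof. by rewrite /restrict_scale scalerA rmorphM. Qed.
Lemma restrict_scale1 : left_id 1 restrict_scale.
Proof. by move=> x; rewrite /restrict_scale rmorph1 scale1r. Qed.
Lemma restrict_scaleDr : right_distributive restrict_scale +%R.
Proof. by move=> a x y; rewrite /restrict_scale; exact: scalerDr. Qed.
Lemma restrict_scaleDl x : {morph restrict_scale^~ x : a b / a + b}.
Proof. by move=> a b; rewrite /restrict_scale rmorphD; exact: scalerDl. Qed.

HB.instance Definition _ := GRing.Zmodule_isLmodule.Build W rM
  restrict_scaleA restrict_scale1 restrict_scaleDr restrict_scaleDl.
End Mod.

Variables (G : preTopologicalGroupType) (V : smoothRep G R).

Lemma restrict_act_linear g :
  linear (act g : restrict_mod eta V -> restrict_mod eta V).
Proof. by move=> a x y; exact: (act_linear g (eta a) x y). Qed.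

Definition restrict : smoothRep G W :=
  SmoothRep restrict_act_linear (@act1 _ _ V) (@actM _ _ V) (@act_smooth _ _ V).

End Restriction.

(** * Subalgebras *)

(* The subring [S] of [A] as a ring; it is a sub-[W]-algebra of [A] when it
   contains the image of the structure map [eta]. *)
Section Subalgebra.
Variables (A : comPzRingType) (S : subringClosed A).

Record subring := MkSubring { subring_val :> A; subring_mem : subring_val \in S }.

HB.instance Definition _ := [isSub for subring_val].
HB.instance Definition _ := [Choice of subring by <:].
HB.instance Definition _ :=
  GRing.SubChoice_isSubComPzRing.Build _ _ subring (subringClosedP S).

Variables (W : pzRingType) (eta : {rmorphism W -> A}).
Hypothesis etaS : forall a, eta a \in S.

Definition corestrict (a : W) : subring := MkSubring (etaS a).

Lemma corestrict_zmod : zmod_morphism corestrict.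
Proof. by move=> a b; apply/val_inj; rewrite rmorphB /= rmorphB. Qed.
Lemma corestrict_monoid : monoid_morphism corestrict.
Proof.
by split=> [|a b]; apply/val_inj; rewrite ?rmorph1 ?rmorphM /= ?rmorph1 ?rmorphM.
Qed.
HB.instance Definition _ :=
  GRing.isZmodMorphism.Build W subring corestrict corestrict_zmod.
HB.instance Definition _ :=
  GRing.isMonoidMorphism.Build W subring corestrict corestrict_monoid.
End Subalgebra.

(** * Whittaker models *)

Section Whittaker.
Variables (p : nat) (F : padicFieldType p) (n : nat).
Variables (A : comPzRingType) (chi : GL F n -> A) (V : smoothRep (GL F n) A).

Local Notation U := (@unipotent p F n).
Local Notation VU := (coinv U chi V).

Definition unipotent_mir : set (mirabolic F n) := [set x | U (mir_gl x)].
Definition chi_mir (S : Type) (c : GL F n -> S) (x : mirabolic F n) : S :=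
  c (mir_gl x).

(* [j] is an [A]-linear and mirabolic-equivariant map from the compact
   induction of [V^(n)] to [V] (the values of [j] elsewhere are irrelevant)
   inducing the identity on coinvariants, those of the compact induction being
   identified with [V^(n)] by evaluation at 1. *)
Record Bernstein_Zelevinsky_map (j : (mirabolic F n -> VU) -> V) : Prop := {
  BZ_linear : forall (a : A) (h h' : mirabolic F n -> VU),
    cInd unipotent_mir (chi_mir chi) h -> cInd unipotent_mir (chi_mir chi) h' ->
    j (fun x => a *: h x + h' x) = a *: j h + j h';
  BZ_equiv : forall (y : mirabolic F n) (h : mirabolic F n -> VU),
    cInd unipotent_mir (chi_mir chi) h ->
    j (fun x => h (x * y)%g) = act (mir_gl y) (j h);
  BZ_coinv : forall h : mirabolic F n -> VU,
    cInd unipotent_mir (chi_mir chi) h -> coinv_proj U chi (j h) = h 1%g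
}.

Definition Whittaker_function (f : VU -> A) (v : V) (g : GL F n) : A :=
  f (coinv_proj U chi (act g v)).

End Whittaker.

(* Main.v *)
(* The vectors of V whose Whittaker function has values in A' form a
   W[G]-submodule V' of V, and every z in the center preserves V' because it
   commutes with the inclusion of V' in V.  Let h in c-Ind_{U}^{P} psi_{A'} be
   supported on U K, for a congruence subgroup K on which psi is trivial, with
   h(1) = 1.  By assumption the image v of h in V lies in V', hence so does
   z v = theta(z) v; and the Whittaker function of v is 1 at the identity, so
   that of z v is theta(z) there. *)
Require Import Defs.
From HB Require Import structures.
From mathcomp Require Import all_boot all_order all_algebra.
From mathcomp Require Import boolp classical_sets topology filter zify ring.

Set Implicit Arguments.
Unset Strict Implicit.
Unset Printing Implicit Defensive.

Import Order.TTheory GRing.Theory Num.Theory.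
Local Open Scope classical_set_scope.
Local Open Scope ring_scope.

(** * Valuation estimates and integral congruences *)

Section Valuation.
Variables (p : nat) (F : padicFieldType p).
Implicit Types (x y : F) (m : int).

Local Notation v := (@padic_val p F).
Local Notation vge := (val_ge v).

Lemma padic_val1 : v 1 = 0.
Proof.
have := padic_valM _ _ (oner_neq0 F) (oner_neq0 F).
by rewrite mulr1; move: (v 1) => a; lia.
Qed.

Lemma padic_valN1 : v (-1) = 0.
Proof.
have N1 : (-1 : F) != 0 by rewrite oppr_eq0 oner_eq0.
by have := padic_valM _ _ N1 N1; rewrite mulrNN mulr1 padic_val1; lia.
Qed.

Lemma padic_valV x : x != 0 -> v x^-1 = - v x.
Proof.
move=> x0; have := padic_valM _ _ x0 (invr_neq0 x0).
by rewrite divff // padic_val1; lia.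
Qed.

Lemma val_ge_0 m : vge m 0. Proof. by left. Qed.
Hint Resolve val_ge_0 : core.

Lemma val_ge_le m m' x : (m' <= m)%R -> vge m x -> vge m' x.
Proof. by move=> le_m [->|le_x]; [left | right; apply: le_trans le_x]. Qed.

Lemma val_geM m m' x y : vge m x -> vge m' y -> vge (m + m') (x * y).
Proof.
case: (eqVneq x 0) => [->|x0]; first by rewrite mul0r.
case: (eqVneq y 0) => [->|y0]; first by rewrite mulr0.
move=> [/eqP|mx]; first by rewrite (negPf x0).
move=> [/eqP|my]; first by rewrite (negPf y0).
by right; rewrite padic_valM // lerD.
Qed.

Lemma val_ge1 : vge 0 1. Proof. by right; rewrite padic_val1. Qed.
Hint Resolve val_ge1 : core.

Lemma val_geN m x : vge m x -> vge m (- x).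
Proof.
move=> mx; rewrite -mulN1r -[m]add0r; apply: val_geM => //.
by right; rewrite padic_valN1.
Qed.

Lemma val_geB m x y : vge m x -> vge m y -> vge m (x - y).
Proof. by move=> mx my; apply: padic_valD => //; exact: val_geN. Qed.

Lemma val_geC m x y : vge m (x - y) -> vge m (y - x).
Proof. by move=> xy; rewrite -opprB; exact: val_geN. Qed.

Lemma val_ge_trans m y x z : vge m (x - y) -> vge m (y - z) -> vge m (x - z).
Proof. by move=> xy yz; rewrite -(subrKA y); exact: padic_valD. Qed.

Lemma val_ge_eq0 x : (forall m, vge m x) -> x = 0.
Proof. by move=> /(_ (v x + 1)) [//|]; lia. Qed.

Lemma val_ge_sum (I : Type) (r : seq I) (P : pred I) (G : I -> F) m :
  (forall i, P i -> vge m (G i)) -> vge m (\sum_(i <- r | P i) G i).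
Proof. by apply: big_ind => // x y; apply: padic_valD. Qed.

Lemma val_ge_delta (T : eqType) (i j : T) : vge 0 (i == j)%:R.
Proof. by case: eqP => _. Qed.

(** Integrality is part of the relation because congruences of a given level can be multiplied only
    between integral elements. *)
Definition integral_cong m x y := [/\ vge 0 x, vge 0 y & vge m (x - y)].

Lemma integral_congM m x x' y y' : integral_cong m x x' ->
  integral_cong m y y' -> integral_cong m (x * y) (x' * y').
Proof.
move=> [x0 x0' xx'] [y0 y0' yy']; split.
- by rewrite -[X in vge X]addr0; apply: val_geM.
- by rewrite -[X in vge X]addr0; apply: val_geM.
have -> : x * y - x' * y' = (x - x') * y + x' * (y - y') by ring.
by apply: padic_valD; [rewrite -[m]addr0|rewrite -[m]add0r]; apply: val_geM.
Qed.

Lemma integral_congD m x x' y y' : integral_cong m x x' ->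
  integral_cong m y y' -> integral_cong m (x + y) (x' + y').
Proof.
move=> [x0 x0' xx'] [y0 y0' yy']; split; try exact: padic_valD.
by rewrite opprD addrACA; exact: padic_valD.
Qed.

Lemma integral_cong_refl m x : vge 0 x -> integral_cong m x x.
Proof. by rewrite /integral_cong subrr. Qed.

Lemma val_ge_sign b : vge 0 ((-1) ^+ b).
Proof. by elim: b => // b IHb; rewrite exprS mulN1r; exact: val_geN. Qed.

(** The Leibniz formula is a polynomial with coefficients 1 and -1 in the entries, and such
    polynomials respect integral congruences. *)
Lemma integral_cong_det m n (A B : 'M[F]_n) :
  (forall i j, integral_cong m (A i j) (B i j)) ->
  integral_cong m (\det A) (\det B).
Proof.
move=> AB; rewrite /determinant; apply: big_ind2 => [|x x' y y'|s _].
- exact: integral_cong_refl.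
- exact: integral_congD.
apply: integral_congM; first exact/integral_cong_refl/val_ge_sign.
apply: big_ind2 => // [|x x' y y']; first exact: integral_cong_refl.
exact: integral_congM.
Qed.

Lemma integral_cong_adj m n (A B : 'M[F]_n) :
  (forall i j, integral_cong m (A i j) (B i j)) ->
  forall i j, integral_cong m (\adj A i j) (\adj B i j).
Proof.
move=> AB i j; rewrite !mxE /cofactor.
apply: integral_congM; first exact/integral_cong_refl/val_ge_sign.
by apply: integral_cong_det => a b; rewrite !mxE.
Qed.

Lemma integral_cong1_unit m x : (0 < m)%R -> integral_cong m x 1 ->
  x != 0 /\ integral_cong m x^-1 1.
Proof.
move=> m0 [x0 _ x1].
have N1 : ~ vge 1 1.
  by move=> [/eqP|]; [rewrite oner_eq0|rewrite padic_val1].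
have x1' : vge 1 (x - 1) by apply: val_ge_le x1; lia.
have xn0 : x != 0.
  apply/eqP => xE; apply: N1.
  by move: x1'; rewrite xE sub0r => /val_geN; rewrite opprK.
have vx : v x = 0.
  (* If [v x] were positive, [1 = x - (x - 1)] would have positive valuation. *)
  case: x0 => [/eqP|x_ge0]; first by rewrite (negPf xn0).
  have [x_gt0|] := boolP (1 <= v x)%R; last by lia.
  case: N1; rewrite -[X in vge _ X](subKr x); apply: val_geB => //.
  by right.
have Vx : vge 0 x^-1 by right; rewrite padic_valV // vx.
split=> //; split=> //.
have -> : x^-1 - 1 = x^-1 * (1 - x) by rewrite mulrBr mulVf ?mulr1.
by rewrite -[m]add0r; apply: val_geM => //; exact: val_geC.
Qed.

(** The determinant is congruent to 1, hence a unit with inverse congruent to 1. The inverse matrix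
    is this scalar times the adjugate, which is congruent to the adjugate of the identity. *)
Lemma congruence_unitmx m n (A : 'M[F]_n) : (0 < m)%R ->
  (forall i j, vge m (A i j - (i == j)%:R)) ->
  A \in unitmx /\ forall i j, vge m (invmx A i j - (i == j)%:R).
Proof.
move=> m0 A1.
have A1' i j : integral_cong m (A i j) (1%:M i j).
  have D := val_ge_delta i j; rewrite mxE; split=> //.
  rewrite -[A i j](subrK (i == j)%:R); apply: padic_valD => //.
  by apply: val_ge_le (A1 i j); lia.
have := integral_cong_det A1'; rewrite det1 => /(integral_cong1_unit m0).
move=> [detA0 detA1].
have uA : A \in unitmx by rewrite unitmxE unitfE.
split=> // i j.
have adj1 : \adj 1%:M = 1%:M :> 'M[F]_n.
  by rewrite -[LHS]mul1mx mul_mx_adj det1.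
have := integral_congM detA1 (integral_cong_adj A1' i j).
by rewrite adj1 /invmx uA mul1r => -[_ _]; rewrite !mxE.
Qed.

(* Finiteness of the residue field lets an ultrafilter choose one residue class
   at each level; these choices form a Cauchy sequence. *)
Lemma integral_ultra_cvg (T : Type) (U : set_system T) (g : T -> F) :
  UltraFilter U -> U [set x | vge 0 (g x)] ->
  exists a : F, forall m, U [set x | vge m (g x - a)].
Proof.
move=> UU U0.
have [t t0 vt] := @padic_uniformizer p F.
have [s sP] := @padic_residue_finite p F.
have vtn (d : nat) : v (t ^+ d) = d%:Z.
  elim: d => [|d IHd]; first by rewrite expr0 padic_val1.
  by rewrite exprS padic_valM ?expf_neq0 // vt IHd; lia.
(* An ultrafilter containing a finite union contains one of its members. *)
have pick (r : seq F) (P : F -> set T) :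
    U [set x | exists2 y, y \in r & P y x] -> exists y, U (P y).
  elim: r => [|y r IHr] Ur.
    by have := filter_not_empty U; case; apply: filterS Ur => x [].
  have [UP|UP] := in_ultra_setVsetC (P y) UU; first by exists y.
  apply: IHr; apply: filterS (filterI Ur UP) => x [] [z].
  by rewrite inE => /orP [/eqP->//|zr Pz _]; exists z.
have approx (d : nat) : exists a, U [set x | vge d%:Z (g x - a)].
  elim: d => [|d [a IHd]].
    by exists 0; apply: filterS U0 => x /=; rewrite subr0.
  (* The next digit: the rescaled error is integral, so it falls into one of the finitely many
     residue classes. *)
  have [y Uy] : exists y, U [set x | vge 1 ((g x - a) / t ^+ d - y)].
    apply: (pick s (fun y => [set x | vge 1 ((g x - a) / t ^+ d - y)])).
    apply: filterS IHd => x /= xa; apply: sP.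
    rewrite -(subrr d%:Z); apply: val_geM => //; right.
    by rewrite padic_valV ?expf_neq0 // vtn.
  exists (a + t ^+ d * y); apply: filterS Uy => x /= xy.
  have -> : g x - (a + t ^+ d * y) = t ^+ d * ((g x - a) / t ^+ d - y).
    by rewrite mulrBr mulrCA divff ?expf_neq0 // mulr1 opprD addrA.
  have -> : (d.+1 : int) = d%:Z + 1 by lia.
  by apply: val_geM => //; right; rewrite vtn.
have {approx} [a aP] := choice approx.
have aC (d d' : nat) : (d <= d')%N -> vge d%:Z (a d - a d').
  move=> dd'; have [x [/= xd xd']] := filter_ex (filterI (aP d) (aP d')).
  apply: (@val_ge_trans _ (g x)); first exact: val_geC.
  by apply: val_ge_le xd'; lia.
have [b ab] : exists b : F, a @ \oo --> b.
  apply: (@padic_complete p F) => m; exists `|m|%N => i j mi mj.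
  apply: (@val_ge_trans _ (a `|m|%N)).
    by apply: val_ge_le (val_geC (aC _ _ mi)); lia.
  by apply: val_ge_le (aC _ _ mj); lia.
exists b => m.
have : nbhs b [set y | vge m (y - b)] by apply/padic_nbhsE; exists m.
move=> /ab [N _ NP].
(* This index is large enough both for [a] to be within level [m] of its limit [b] and for [g] to be
   within level [m] of [a]. *)
apply: filterS (aP (maxn N `|m|)) => x /= xa.
apply: (@val_ge_trans _ (a (maxn N `|m|))); last first.
  by apply: NP; rewrite /= leq_maxl.
by apply: val_ge_le xa; lia.
Qed.

End Valuation.

(** * Topology of the mirabolic subgroup and its congruence subgroups *)

Section MirabolicTopology.
Variables (p : nat) (F : padicFieldType p) (n : nat).

Local Notation vge := (val_ge (@padic_val p F)).
Local Notation P := (mirabolic F n).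

Definition mx_close (m : int) (A B : 'M[F]_n) :=
  forall i j, vge m (A i j - B i j).

Lemma mirabolic_nbhsP (x : P) (S : set P) :
  nbhs x S <-> exists m, forall y : P, mx_close m y x -> S y.
Proof.
split=> [|[m mS]].
  rewrite nbhsE => -[_ [[_ [B oB <-] <-] xB] BS].
  have /open_nbhs_nbhs [C nC CB] : open_nbhs (gl_mx x) B by [].
  have /choice [M MC] : forall ij : 'I_n * 'I_n, exists m, forall y,
      vge m (y - gl_mx x ij.1 ij.2) -> C ij.1 ij.2 y.
    by move=> [a b]; apply/padic_nbhsE/nC.
  (* The sum of absolute values serves as a common upper bound for the levels required at the
     individual entries. *)
  exists (\sum_ij `|M ij|) => y yx; apply/BS/CB => a b.
  apply: (MC (a, b)); apply: (val_ge_le _ (yx a b)).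
  rewrite (bigD1 (a, b)) //=; apply: le_trans (ler_norm _) _.
  by rewrite lerDl sumr_ge0.
have nB : nbhs (gl_mx x) [set A | mx_close m A (gl_mx x)].
  exists (fun i j => [set a | vge m (a - gl_mx x i j)]) => [i j|A AB i j].
    by apply/(padic_nbhsE (p:=p)); exists m.
  exact: AB.
have nG := @initial_continuous _ _ (@gl_mx p F n) (mir_gl x) _ nB.
have nP : nbhs x [set y : P | mx_close m y x].
  exact: (@initial_continuous _ _ (@mir_gl p F n) x _ nG).
exact: filterS nP.
Qed.

(** For [0 < m], the intersection of the mirabolic subgroup with the principal congruence subgroup
    of level [m] of the integral matrices. *)
Definition congruence_subgroup (m : int) : set P :=
  [set x | mx_close m x 1%:M].

Lemma mir_mxM (x y : P) : gl_mx (x * y)%g = gl_mx x *m gl_mx y.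
Proof. by []. Qed.

Lemma mir_mxV (x : P) : gl_mx (x^-1)%g = invmx (gl_mx x).
Proof. by []. Qed.

Lemma congruence_subgroup1 m : congruence_subgroup m 1%g.
Proof. by move=> i j; rewrite subrr; exact: val_ge_0. Qed.

Lemma congruence_subgroupV m x : (0 < m)%R ->
  congruence_subgroup m x -> congruence_subgroup m (x^-1)%g.
Proof.
move=> m0 Kx i j; rewrite mir_mxV mxE.
have [|_] := congruence_unitmx m0 (A := gl_mx x); last exact.
by move=> a b; have := Kx a b; rewrite mxE.
Qed.

Lemma congruence_subgroupM m x y : (0 < m)%R -> congruence_subgroup m x ->
  congruence_subgroup m y -> congruence_subgroup m (x * y)%g.
Proof.
move=> m0 Kx Ky i j; rewrite mir_mxM.
have -> : gl_mx x *m gl_mx y =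
    (gl_mx x - 1%:M) *m (gl_mx y - 1%:M) + (gl_mx x - 1%:M)
    + (gl_mx y - 1%:M) + 1%:M.
  rewrite mulmxBl !mulmxBr !mul1mx !mulmx1 (addrAC _ (gl_mx x - _)).
  by rewrite subrK addrA !subrK.
rewrite [(_ + 1%:M) i j]mxE addrK.
rewrite [(_ + (gl_mx y - _)) i j]mxE [(_ + (gl_mx x - _)) i j]mxE.
have E (B : 'M[F]_n) a b : (B - 1%:M) a b = B a b - (1%:M : 'M[F]_n) a b.
  by rewrite !mxE.
rewrite !E; apply: padic_valD; last exact: Ky.
apply: padic_valD; last exact: Kx.
rewrite mxE; apply: val_ge_sum => k _; rewrite !E.
by apply: (@val_ge_le _ _ (m + m)); [lia|apply: val_geM].
Qed.

(** Used to get openness from right invariance. The structure carries no continuity of the group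
    law, so it is checked on entries from [x^-1 y - 1 = x^-1 (y - x)]. *)
Lemma congruence_subgroup_nbhs m (x : P) (S : set P) : (0 < m)%R ->
  (forall y, congruence_subgroup m y -> S (x * y)%g) -> nbhs x S.
Proof.
move=> m0 KS; apply/mirabolic_nbhsP.
pose M := invmx (gl_mx x).
(* The sum compensates for the denominators of the inverse of [x]: each entry of [M] has valuation
   at least its negative. *)
exists (m + \sum_(ij : 'I_n * 'I_n) `|padic_val (M ij.1 ij.2)|) => y yx.
rewrite -[y](mulVKg x); apply: KS => i j.
rewrite mir_mxM mir_mxV -(mulVmx (gl_unit x)) -/M.
have -> : (M *m gl_mx y) i j - (M *m gl_mx x) i j =
    (M *m (gl_mx y - gl_mx x)) i j.
  by rewrite mulmxBr !mxE.
rewrite mxE; apply: val_ge_sum => k _.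
set c := \sum_(_ | _) _ in yx.
have -> : m = - c + (m + c) by lia.
apply: val_geM; last by rewrite !mxE; apply: yx.
right; rewrite lerNl /c (bigD1 (i, k)) //= -normrN.
by apply: le_trans (ler_norm _) _; rewrite lerDl sumr_ge0.
Qed.

Lemma congruence_subgroup_compact m : (0 < m)%R ->
  compact (congruence_subgroup m).
Proof.
move=> m0; rewrite compact_ultra => U UU UK.
have entry (ij : 'I_n * 'I_n) : exists a, forall d,
    U [set x : P | vge d (gl_mx x ij.1 ij.2 - a)].
  apply: integral_ultra_cvg; apply: filterS UK => x /(_ ij.1 ij.2) Kx.
  have D := val_ge_delta F ij.1 ij.2.
  rewrite /= -[gl_mx x _ _](subrK (ij.1 == ij.2)%:R); apply: padic_valD => //.
  by rewrite mxE in Kx; apply: val_ge_le Kx; lia.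
have {entry} [a aP] := choice entry.
(* Balls are closed: by the ultrametric inequality, a bound holding along the ultrafilter passes to
   the limit entry. *)
have limit i j : forall d b, U [set x : P | vge d (gl_mx x i j - b)] ->
    vge d (a (i, j) - b).
  move=> d b Ub; have [x [/= xa xb]] := filter_ex (filterI (aP (i, j) d) Ub).
  by apply: (@val_ge_trans _ _ _ (gl_mx x i j)) => //; exact: val_geC.
pose M : 'M[F]_n := \matrix_(i, j) a (i, j).
have M1 i j : vge m (M i j - (i == j)%:R).
  rewrite mxE; apply: limit; apply: filterS UK => x /(_ i j).
  by rewrite mxE.
have [uM _] := congruence_unitmx m0 M1.
(* The last row is constant along the ultrafilter, so its limit differs from it by an element of
   arbitrarily large valuation. *)
have mM : MkGL uM \in @mirabolic_pred p F n.
  apply/mirabolicP => i j il; rewrite mxE; apply/eqP; rewrite -subr_eq0.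
  apply/eqP/(@val_ge_eq0 _ F) => d; apply: limit.
  apply: filterS (@filterT _ U _) => x _ /=.
  have /mirabolicP -> // := mir_pred x.
  by rewrite subrr; exact: val_ge_0.
exists (MkMirabolic mM); split=> [i j|S].
  by rewrite [gl_mx _]/= [X in _ - X]mxE; exact: M1.
move=> /mirabolic_nbhsP [d dS].
have : U [set x : P | forall ij, vge d (gl_mx x ij.1 ij.2 - a ij)].
  (* Filters are stable under finite intersections only, hence the induction on a list of
     entries. *)
  suff H (s : seq ('I_n * 'I_n)) :
      U [set x : P | forall ij, ij \in s -> vge d (gl_mx x ij.1 ij.2 - a ij)].
    by apply: filterS (H (index_enum _)) => x + ij; apply; exact: mem_index_enum.
  elim: s => [|ij s IHs]; first by apply: filterS (@filterT _ U _).
  apply: filterS (filterI (aP ij d) IHs) => x [/= xij xs] kl.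
  by rewrite inE => /orP [/eqP ->|/xs].
apply: filterS => x xd; apply: dS => i j.
by rewrite [gl_mx (mir_gl (MkMirabolic _))]/= mxE; exact: (xd (i, j)).
Qed.

End MirabolicTopology.

(** * A compactly induced function supported on [U K] *)

Section CompactInduction.
Variables (p : nat) (F : padicFieldType p) (n : nat).

Local Notation P := (mirabolic F n).
Local Notation K := (@congruence_subgroup p F n).

Variables (R : pzRingType) (U : set P) (chi : P -> R) (m : int).
Hypotheses (m_gt0 : 0 < m) (U_subgroup : subgroup U).
Hypothesis chiM : forall u v, U u -> U v -> chi (u * v)%g = chi u * chi v.
Hypothesis chi_congruence : forall u, U u -> K m u -> chi u = 1.

(** Extension by zero of [u c |-> chi u] from [U K]. The factor [u] is chosen arbitrarily; [bumpE]
    shows that the choice is harmless. *)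
Definition bump (x : P) : R^o :=
  if pselect (exists u, U u /\ K m (u^-1 * x)%g) is left ex
  then chi (projT1 (cid ex)) else 0.

(** Two possible choices of the unipotent factor differ by an element of [U] that lies in [K m],
    where [chi] is trivial. *)
Lemma bumpE u x : U u -> K m x -> bump (u * x)%g = chi u.
Proof.
have [_ UM UV] := U_subgroup.
move=> Uu Kx; rewrite /bump; case: pselect => [ex|[]]; last first.
  by exists u; rewrite mulKg.
case: cid => w /= [Uw Kw].
have Kwu : K m (w^-1 * u)%g.
  rewrite -[(w^-1 * u)%g](mulgK x) -(mulgA w^-1%g).
  by apply: congruence_subgroupM => //; exact: congruence_subgroupV.
have Uwu : U (w^-1 * u)%g by apply: UM => //; exact: UV.
by rewrite -[u](mulVKg w) chiM // (chi_congruence Uwu) // mulr1.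
Qed.

Lemma bump_eq0 x :
  ~ (exists u c, [/\ U u, K m c & x = (u * c)%g]) -> bump x = 0.
Proof.
move=> N; rewrite /bump; case: pselect => // -[u [Uu Ku]].
by case: N; exists u, (u^-1 * x)%g; rewrite mulVKg.
Qed.

Lemma bump_equiv u x : U u -> bump (u * x)%g = chi u *: bump x.
Proof.
have [U1 UM UV] := U_subgroup => Uu.
have [[w [c [Uw Kc ->]]]|N] :=
    pselect (exists w c, [/\ U w, K m c & x = (w * c)%g]).
  by rewrite mulgA !bumpE ?chiM //; exact: UM.
rewrite (bump_eq0 N) scaler0; apply: bump_eq0 => -[w [c [Uw Kc E]]].
apply: N; exists (u^-1 * w)%g, c; split=> //; first by apply: UM => //; exact: UV.
by rewrite -mulgA -E mulKg.
Qed.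

Lemma bump_congruence x c : K m c -> bump (x * c)%g = bump x.
Proof.
move=> Kc.
have [[w [d [Uw Kd ->]]]|N] :=
    pselect (exists w d, [/\ U w, K m d & x = (w * d)%g]).
  by rewrite -mulgA !bumpE //; exact: congruence_subgroupM.
rewrite (bump_eq0 N); apply: bump_eq0 => -[w [d [Uw Kd E]]].
apply: N; exists w, (d * c^-1)%g; split=> //.
  by apply: congruence_subgroupM => //; exact: congruence_subgroupV.
by rewrite mulgA -E mulgK.
Qed.

(** Smoothness comes from right invariance under [K m], and the support condition from compactness
    of [K m]. *)
Lemma bump_cInd : cInd U chi bump.
Proof.
split; [split=> [u g|]|].
- exact: bump_equiv.
- rewrite openE => x /= xP; apply: (congruence_subgroup_nbhs m_gt0) => y Ky g.
  by rewrite mulgA bump_congruence.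
- exists (K m); split; first exact: congruence_subgroup_compact.
  by move=> x; apply: contra_notP => /bump_eq0.
Qed.

Lemma bump1 : bump 1%g = 1.
Proof.
have [U1 _ _] := U_subgroup; have K1 := @congruence_subgroup1 p F n m.
by rewrite -[1%g in LHS]mulg1 bumpE // chi_congruence.
Qed.


End CompactInduction.

(** * The unipotent group and its character *)

Section Unipotent.
Variables (p : nat) (F : padicFieldType p) (n : nat).
Local Notation U := (@unipotent p F n).

Lemma unipotentM (u v : GL F n) : U u -> U v -> U (u * v)%g.
Proof.
move=> Uu Uv i j ji; rewrite [gl_mx _]/= mxE (bigD1 i) //=.
rewrite Uu // eqxx mul1r Uv // big1 ?addr0 // => k ki.
have [ik|ik] := leqP i k; last first.
  by rewrite Uu ?(ltnW ik) // eq_sym (negPf ki) mul0r.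
have {ki ik} ik : (i < k)%N by rewrite ltn_neqAle ik andbT eq_sym.
rewrite Uv; last exact: leq_trans ji (ltnW ik).
by have [kj|] := eqVneq k j; [move: ji; rewrite -kj leqNgt ik|rewrite mulr0].
Qed.

Lemma unipotentV (u : GL F n) : U u -> U (u^-1)%g.
Proof.
(* Induction on the rows from the bottom up: row [i] of [u u^-1 = 1] determines row [i] of the
   inverse, on and below the diagonal, from the later rows. *)
move=> Uu i; have [d] := ubnP (n - i); elim: d i => // d IHd i id j ji.
have : (gl_mx u *m gl_mx (u^-1)%g) i j = (i == j)%:R.
  by rewrite [gl_mx (_^-1)%g]/= mulmxV ?gl_unit // mxE.
rewrite mxE (bigD1 i) //= Uu // eqxx mul1r big1 ?addr0 // => k ki.
have [ik|ik] := leqP i k; last first.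
  by rewrite Uu ?(ltnW ik) // eq_sym (negPf ki) mul0r.
have {ki ik} ik : (i < k)%N by rewrite ltn_neqAle ik andbT eq_sym.
rewrite IHd; [|by have := ltn_ord k; lia|exact: leq_trans ji (ltnW ik)].
by have [kj|] := eqVneq k j; [move: ji; rewrite -kj leqNgt ik|rewrite mulr0].
Qed.

(** In the entry of [u v] at row [i] and column [i + 1], triangularity leaves only the two terms
    with middle index [i] or [i + 1]. *)
Lemma superdiag_sumM (u v : GL F n) : U u -> U v ->
  superdiag_sum (u * v)%g = superdiag_sum u + superdiag_sum v.
Proof.
move=> Uu Uv; rewrite /superdiag_sum -big_split; apply: eq_bigr => i _.
rewrite -big_split; apply: eq_bigr => j /eqP ij /=.
have ineqj : i != j by apply/eqP => E; move: ij; rewrite E; lia.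
rewrite -[LHS]/((gl_mx u *m gl_mx v) i j).
rewrite mxE (bigD1 i) //= (bigD1 j) /=; last by rewrite eq_sym.
rewrite (Uu i i) // (Uv j j) // !eqxx mul1r mulr1.
rewrite big1 ?addr0 1?addrC // => k /andP [ki kj].
have [ik|ik] := ltnP i k; last by rewrite Uu // eq_sym (negPf ki) mul0r.
have jk : (j <= k)%N by rewrite ij.
by rewrite Uv // (negPf kj) mulr0.
Qed.

Lemma unipotent_mir_subgroup : subgroup (@unipotent_mir p F n).
Proof.
split=> [i j _|x y|x]; last exact: unipotentV; last exact: unipotentM.
by rewrite mxE.
Qed.

Lemma psi_congruence (W : comNzRingType) (psi : F -> W) :
  nontrivial_smooth_character psi -> exists2 m : int, 0 < m &
    forall x, val_ge (@padic_val p F) m x -> psi x = 1.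
Proof.
move=> psiP.
have : nbhs (0 : F) [set x | psi x = 1].
  by apply: open_nbhs_nbhs; split; [exact: psi_smooth|exact: psi0].
(* The level is raised to at least 1 so that the congruence set is a group. *)
move=> /padic_nbhsE [m mP]; exists (Order.max m 1).
  by rewrite lt_max ltr01 orbT.
move=> x mx; apply: mP; rewrite subr0; apply: val_ge_le mx.
by rewrite le_max lexx.
Qed.

Lemma superdiag_sum_congruence m (x : mirabolic F n) :
  congruence_subgroup m x -> val_ge (@padic_val p F) m (superdiag_sum x).
Proof.
move=> Kx; apply: val_ge_sum => i _; apply: val_ge_sum => j /eqP ij.
have := Kx i j; rewrite mxE; case: eqP => [E|_]; last by rewrite subr0.
by move: ij; rewrite E; lia.
Qed.

(** The coefficient ring is general because the test function must have values in [subring A'], not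
    merely in [A]. *)
Lemma cInd_psiU_eq1 (W : comNzRingType) (psi : F -> W) (R : pzRingType)
    (eta : {rmorphism W -> R}) : nontrivial_smooth_character psi ->
  exists2 h : mirabolic F n -> R^o,
    cInd (@unipotent_mir p F n) (chi_mir (psiU eta psi)) h & h 1%g = 1.
Proof.
move=> psiP; have [m m0 mP] := psi_congruence psiP.
have US := unipotent_mir_subgroup.
have chiM (u v : mirabolic F n) : unipotent_mir u -> unipotent_mir v ->
    chi_mir (psiU eta psi) (u * v)%g =
    chi_mir (psiU eta psi) u * chi_mir (psiU eta psi) v.
  move=> Uu Uv; rewrite /chi_mir /psiU -rmorphM -psiD //.
  by rewrite -superdiag_sumM.
have chi1 (u : mirabolic F n) : unipotent_mir u -> congruence_subgroup m u ->
    chi_mir (psiU eta psi) u = 1.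
  move=> _ Ku; rewrite /chi_mir /psiU mP ?rmorph1 //.
  exact: superdiag_sum_congruence.
exists (bump (@unipotent_mir p F n) (chi_mir (psiU eta psi)) m).
  exact: bump_cInd.
exact: bump1.
Qed.

End Unipotent.

(** * Stability of subrepresentations under the center *)

Section Subrepresentation.
Variables (G : preTopologicalGroupType) (R : pzRingType) (V : smoothRep G R).
Variable S : submodClosed V.
Hypothesis act_S : forall g v, v \in S -> act g v \in S.

Record subrep := MkSubrep { subrep_val :> V; subrep_mem : subrep_val \in S }.

HB.instance Definition _ := [isSub for subrep_val].
HB.instance Definition _ := [Choice of subrep by <:].
HB.instance Definition _ :=
  GRing.SubChoice_isSubLmodule.Build _ _ _ subrep (submodClosedP S).

Definition subrep_act (g : G) (v : subrep) : subrep :=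
  MkSubrep (act_S g (subrep_mem v)).

Lemma subrep_act_linear g : linear (subrep_act g).
Proof. by move=> a v w; apply/val_inj; rewrite /= act_linear. Qed.

Lemma subrep_act1 v : subrep_act 1%g v = v.
Proof. by apply/val_inj; rewrite /= act1. Qed.

Lemma subrep_actM g h v : subrep_act (g * h)%g v = subrep_act g (subrep_act h v).
Proof. by apply/val_inj; rewrite /= actM. Qed.

Lemma subrep_act_smooth v : open [set g | subrep_act g v = v].
Proof.
suff -> : [set g | subrep_act g v = v] = [set g | act g (val v) = val v].
  exact: act_smooth.
by apply/seteqP; split=> g /= => [/(congr1 val)|E] //; apply/val_inj.
Qed.

Definition subrep_rep : smoothRep G R :=
  SmoothRep subrep_act_linear subrep_act1 subrep_actM subrep_act_smooth.

Definition subrep_incl : {linear subrep_rep -> V} := (val : subrep -> V).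

Lemma subrep_incl_equiv g v : subrep_incl (act g v) = act g (subrep_incl v).
Proof. by []. Qed.

Lemma center_subrep (z : center G R) v : v \in S -> z V v \in S.
Proof.
move=> Sv.
rewrite (center_natural z (RepHom subrep_incl_equiv) (MkSubrep Sv)).
exact: subrep_mem.
Qed.

End Subrepresentation.

(** * Vectors whose matrix coefficients lie in a subring *)

Section MatrixCoefficients.
Variables (G : preTopologicalGroupType) (W A : comPzRingType).
Variables (eta : {rmorphism W -> A}) (A' : subringClosed A).
Hypothesis etaA' : forall a, eta a \in A'.
Variables (V : smoothRep G A) (phi : {linear V -> A^o}).

(** When [phi] is [f] composed with the projection to coinvariants, these coefficients are the
    values of the Whittaker function. The predicate lives on the restriction to [W], since it need
    not be stable under [A] and the center acts on representations over [W]. *)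
Definition coef_mem : {pred restrict eta V} := fun v =>
  `[< forall g : G, (phi (act g (v : V)) : A) \in A' >].

Lemma coef_mem_closed : submod_closed coef_mem.
Proof.
have act0 (g : G) : act g (0 : V) = 0.
  by have := act_linear g (-1) (0 : V) 0; rewrite scaler0 addr0 scaleN1r addNr.
split=> [|a v w /asboolP Sv /asboolP Sw]; apply/asboolP => g.
  by rewrite act0 raddf0; exact: rpred0.
rewrite (act_linear g (eta a) (v : V) w) linearP.
by apply: rpredD (Sw g); apply: rpredM (etaA' a) (Sv g).
Qed.

HB.instance Definition _ :=
  GRing.isSubmodClosed.Build W (restrict eta V) coef_mem coef_mem_closed.

Lemma coef_mem_act (g : G) (v : restrict eta V) :
  v \in coef_mem -> act g v \in coef_mem.
Proof.
by move=> /asboolP Sv; apply/asboolP => h; rewrite /= -actM; exact: Sv.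
Qed.

Lemma center_coef (z : center G W) (a : A) (v : V) :
  (forall v, z (restrict eta V) v = a *: (v : V)) ->
  (forall g, (phi (act g v) : A) \in A') -> phi v = 1 -> a \in A'.
Proof.
move=> za Sv phi1.
have Sv' : (v : restrict eta V) \in coef_mem by apply/asboolP.
have /asboolP /(_ 1%g) := center_subrep coef_mem_act z Sv'.
by rewrite za act1 linearZ /= phi1 [_ *: _]mulr1.
Qed.

End MatrixCoefficients.

(** * Change of coefficients and the factorization through [A'] *)

Lemma cInd_comp (G : preTopologicalGroupType) (R R' : pzRingType) (U : set G)
    (chi : G -> R) (M : lmodType R) (M' : lmodType R') (s : R -> R') (q : M -> M') :
  injective q -> q 0 = 0 -> (forall a x, q (a *: x) = s a *: q x) ->
  forall h, cInd U chi h -> cInd U (s \o chi) (q \o h).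
Proof.
move=> q_inj q0 qZ h [[hU h_smooth] [C [Cc hC]]]; split; [split|].
- by move=> u g Uu /=; rewrite hU.
(* Since [q] is injective, [h] and [q \o h] have the same right stabilizer. *)
- suff -> : [set k | forall g, (q \o h) (g * k)%g = (q \o h) g] =
      [set k | forall g, h (g * k)%g = h g] by [].
  by apply/seteqP; split=> k /= H g; [exact/q_inj/H|rewrite H].
- exists C; split=> // g qhg; apply: hC => hg; apply: qhg.
  by rewrite /= hg.
Qed.

Section CoinvProj.
Variables (G : preTopologicalGroupType) (R : pzRingType).
Variables (U : set G) (chi : G -> R) (V : smoothRep G R).

(** Makes [f] composed with the projection available as the linear functional [phi] of
    [center_coef]. *)
Lemma coinv_proj_linear : linear (@coinv_proj G R U chi V).
Proof. by move=> a v w; rewrite coinv_projD coinv_projZ. Qed.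

HB.instance Definition _ := GRing.isLinear.Build R V (coinv U chi V) _
  (@coinv_proj G R U chi V) coinv_proj_linear.
End CoinvProj.

Theorem theorem3p2
  (p : nat) (F : padicFieldType p) (n : nat) (n_gt0 : (0 < n)%N)
  (l : nat) (k : closedFieldType) (lp : l != p)
  (W : comNzRingType) (red : {rmorphism W -> k}) (Wk : is_Witt_ring l red)
  (psi : F -> W) (psiP : nontrivial_smooth_character psi)
  (A : comPzRingType) (eta : {rmorphism W -> A})
  (e : center (GL F n) W) (eP : primitive_idempotent e)
  (V : smoothRep (GL F n) A)
  (Vcow : co_Whittaker (@unipotent p F n) (psiU eta psi) V)
  (Ve : in_block e (restrict eta V))
  (f : {linear coinv (@unipotent p F n) (psiU eta psi) V -> A^o})
  (finv : A -> coinv (@unipotent p F n) (psiU eta psi) V)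
  (fK : cancel f finv) (finvK : cancel finv f)
  (A' : subringClosed A) (etaA' : forall a : W, eta a \in A')
  (j : (mirabolic F n -> coinv (@unipotent p F n) (psiU eta psi) V) -> V)
  (jP : Bernstein_Zelevinsky_map j)
  (image_in_A' : forall h : mirabolic F n -> (subring A')^o,
    cInd (@unipotent_mir p F n) (chi_mir (psiU (corestrict etaA') psi)) h ->
    exists2 w : GL F n -> (subring A')^o,
      Ind (@unipotent p F n) (psiU (corestrict etaA') psi) w &
      forall g : GL F n,
        Whittaker_function f (j (fun x => finv (subring_val (h x)))) g =
        subring_val (w g))
  (theta : block_center e -> A)
  (thetaP : forall (z : block_center e) (v : V),
    sval z (restrict eta V) v = theta z *: v) :
  exists theta' : block_center e -> subring A',
    forall z : block_center e, theta z = subring_val (theta' z).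
Proof.
suff thetaA' z : theta z \in A' by exists (fun z => MkSubring (thetaA' z)).
have [h hI h1] :=
  @cInd_psiU_eq1 p F n W psi (subring A') (corestrict etaA') psiP.
have [w _ wE] := image_in_A' h hI.
pose v := j (fun x => finv (subring_val (h x))).
(* [finv] is given only as a function; its compatibility with scalars is inherited from [f]. *)
have finvZ a b : finv (a * b) = a *: finv b.
  by apply: (can_inj fK); rewrite linearZ /= !finvK.
(* The value of [j] on coinvariants is known only on the compact induction of the coinvariants over
   [A], so [h] is transported there along the semilinear injection [q]. *)
have hI' : cInd (@unipotent_mir p F n) (chi_mir (psiU eta psi))
    (fun x => finv (subring_val (h x))).
  pose q (a : (subring A')^o) : coinv (@unipotent p F n) (psiU eta psi) V :=
    finv (subring_val a).
  have q_inj : injective q.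
    by apply: inj_comp; [exact: can_inj finvK|exact: val_inj].
  have q0 : q 0 = 0 by rewrite /q -[subring_val 0](mul0r (0 : A)) finvZ scale0r.
  have qZ a x : q (a *: x) = subring_val a *: q x by rewrite -finvZ.
  (* Composing the character over [A'] with the inclusion gives the one over [A] by computation. *)
  exact: (cInd_comp q_inj q0 qZ hI).
apply: (@center_coef _ W A eta A' etaA' V
  (f \o @coinv_proj _ _ _ _ V) (sval z) _ v).
- exact: thetaP.
- move=> g; have := wE g; rewrite /Whittaker_function /= => ->.
  exact: subring_mem.
- by rewrite /= (BZ_coinv jP hI') finvK h1.
Qed.
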